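(* Let $\Lambda$ be a countable index set, $\mathbb{Y}$ a Banach space, and $(\overline{a}_j)_{j\in\Lambda}$, $(\overline{r}_j)_{j\in\Lambda}$ sequences of positive reals with $\overline{a}_j\overline{r}_j^{-1}\to 0$ (i.e. for every $\varepsilon>0$ all but finitely many $j$ satisfy $\overline{a}_j\overline{r}_j^{-1}\le\varepsilon$). For positive weights $\omega$ write $\|x\|_{\omega,p}=(\sum_{j}\omega_j^p|x_j|^p)^{1/p}$ and $\ell^p_\omega=\{x:\|x\|_{\omega,p}<\infty\}$. Suppose that $D\subseteq\ell^2_{\overline{a}}$ is closed with $D\cap\ell^1_{\overline{r}}\neq\emptyset$, and that $F\colon D\to\mathbb{Y}$ satisfies, for some $L>0$, $$\tfrac1L\|x^{(1)}-x^{(2)}\|_{\overline{a},2}\le\|F(x^{(1)})-F(x^{(2)})\|_{\mathbb{Y}}\le L\|x^{(1)}-x^{(2)}\|_{\overline{a},2}\quad\text{for all }x^{(1)},x^{(2)}\in D.$$ For $t\in(0,2)$ let $\|x\|_{k_t}=\sup_{\alpha>0}\alpha\big(\sum_{j\in\Lambda}\overline{a}_j^{-2}\overline{r}_j^2\mathbb{1}_{\{\overline{a}_j^{-2}\overline{r}_j\alpha<|x_j|\}}\big)^{1/t}$. Let $t\in(0,1)$, $\varrho>0$ and $x^+\in D$. If $\|x^+\|_{k_t}\le\varrho$, then the variational source condition $$\|x^+-x\|_{\overline{r},1}+\|x^+\|_{\overline{r},1}-\|x\|_{\overline{r},1}\le C_{\mathrm{vsc}}\|F(x^+)-F(x)\|_{\mathbb{Y}}^{\frac{2-2t}{2-t}}\quad\text{for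 all }x\in D\cap\ell^1_{\overline{r}}$$ holds with $C_{\mathrm{vsc}}=(2+4(2^{1-t}-1)^{-1})L^{\frac{2-2t}{2-t}}\varrho^{\frac{t}{2-t}}$. If in addition $D$ is closed under coordinate shrinkage (i.e. $x\in D$, $z\in\ell^2_{\overline{a}}$ with $|z_j|\le|x_j|$ for all $j$ implies $z\in D$), then this variational source condition implies $\|x^+\|_{k_t}\le L^{\frac{2-2t}{t}}C_{\mathrm{vsc}}^{\frac{2-t}{t}}$.
   Context: Setting: weighted $\ell^1$ Tikhonov regularization for a possibly nonlinear forward operator $F$ mapping sequences to a Banach space $\mathbb{Y}$, with two-sided Lipschitz bounds relative to the weighted $\ell^2$ norm $\|\cdot\|_{\overline{a},2}$. The quasi-norm $\|\cdot\|_{k_t}$ defines a weak (weighted Lorentz-type) sequence space $k_t$. *)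

(* Defs.v *)
From HB Require Import structures.
From mathcomp Require Import all_boot all_order all_algebra.
From mathcomp Require Import all_classical all_reals all_analysis.
Set Implicit Arguments. Unset Strict Implicit. Unset Printing Implicit Defensive.
Import Order.TTheory GRing.Theory Num.Theory.
Import numFieldNormedType.Exports.
Local Open Scope classical_set_scope.
Local Open Scope ring_scope.

Section Defs.
Variables (R : realType) (Lam : countType).

Definition wnorm (w : Lam -> R) (p : R) (x : Lam -> R) : \bar R :=
  ((\esum_(j in setT) ((w j * `|x j|) `^ p)%:E) `^ p^-1)%E.

Definition in_lp (w : Lam -> R) (p : R) (x : Lam -> R) : Prop :=
  (wnorm w p x < +oo)%E.

Definition seqsub (x y : Lam -> R) : Lam -> R := fun j => x j - y j.

Definition kt_norm (a r : Lam -> R) (t : R) (x : Lam -> R) : \bar R :=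
  ereal_sup [set (alpha%:E *
      ((\esum_(j in setT)
          (if a j ^-2 * r j * alpha < `|x j| then a j ^-2 * r j ^+ 2 else 0)%:E)
        `^ t^-1))%E | alpha in [set alpha : R | 0 < alpha]].

Definition closed_in_l2 (a : Lam -> R) (D : set (Lam -> R)) : Prop :=
  D `<=` in_lp a 2 /\
  forall x, in_lp a 2 x ->
    (forall eps : R, 0 < eps -> exists2 y, D y & (wnorm a 2 (seqsub x y) < eps%:E)%E) ->
    D x.

Definition ratio_to_zero (a r : Lam -> R) : Prop :=
  forall eps : R, 0 < eps -> finite_set [set j | eps < a j / r j].

Definition shrink_closed (a : Lam -> R) (D : set (Lam -> R)) : Prop :=
  forall x z, D x -> in_lp a 2 z -> (forall j, `|z j| <= `|x j|) -> D z.

Definition vsc (Y : normedModType R) (r : Lam -> R) (D : set (Lam -> R))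
    (F : (Lam -> R) -> Y) (xp : Lam -> R) (C e : R) : Prop :=
  forall x, D x -> in_lp r 1 x ->
    (wnorm r 1 (seqsub xp x) + wnorm r 1 xp - wnorm r 1 x
       <= (C * (`|F xp - F x| `^ e))%:E)%E.

End Defs.

(* Main.v *)
Require Import Defs.
From HB Require Import structures.
From mathcomp Require Import all_boot all_order all_algebra.
From mathcomp Require Import all_classical all_reals all_analysis.
From mathcomp Require Import ring lra.
Import Order.TTheory GRing.Theory Num.Theory.
Import numFieldNormedType.Exports.
Local Open Scope classical_set_scope.
Local Open Scope ring_scope.

(** Let xi_j = a_j^-2 r_j, and recall that the k_t bound controls
    M(b) = sum of xi_j r_j over the j with xi_j b < |x+_j| by rho^t b^-t.

    Source condition: a coordinate contributes at most 2 r_j |x+_j - x_j| and at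
    most 2 r_j |x+_j|. Use the first bound where |x+_j| > xi_j b, splitting it by
    AM-GM into b xi_j r_j + a_j^2 |x+_j - x_j|^2 / b, and the second elsewhere.
    The sum T(b) of r_j |x+_j| over the small coordinates satisfies
    T(b) <= b M(b/2) + T(b/2), which iterates to a geometric series. With
    E = L ||F(x+) - F(x)||, taking b^(2-t) = E^2 rho^-t balances all terms.

    Converse: test the source condition with x+ soft-thresholded by xi_j b on a
    finite set of coordinates exceeding this threshold. Both norms of the
    difference are then explicit in b and n = sum of xi_j r_j over that set,
    and solving for n gives the k_t bound. *)

(** * Sums over the index set against finite lists, and the weighted norms *)

Lemma esum_le_seq (R : realType) (I : choiceType) (f : I -> R) (M : \bar R) :
  (forall s : seq I, uniq s -> ((\sum_(j <- s) f j)%:E <= M)%E) ->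
  (\esum_(j in setT) (f j)%:E <= M)%E.
Proof.
move=> fM; apply: ge_ereal_sup => _ [A [Afin _] <-].
by rewrite fsbig_finite // sumEFin fM ?finmap.fset_uniq.
Qed.

Lemma seq_le_esum (R : realType) (I : choiceType) (f : I -> R) (s : seq I) :
  uniq s -> ((\sum_(j <- s) f j)%:E <= \esum_(j in setT) (f j)%:E)%E.
Proof.
move=> us; apply: esum_ge; exists [set` s]; first by split.
by rewrite -fsbig_seq // sumEFin.
Qed.

(** Serves the converse, where the test sequence differs from [xp] only on a finite list and both
    norms of the difference are computed exactly. *)
Lemma esum_seq_supp (R : realType) (I : choiceType) (f : I -> R) (s : seq I) :
  (forall j, 0 <= f j) -> uniq s -> (forall j, j \notin s -> f j = 0) ->
  \esum_(j in setT) (f j)%:E = (\sum_(j <- s) f j)%:E.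
Proof.
move=> f0 us fs; rewrite -sumEFin fsbig_seq // -esum_fset //; last first.
  by move=> i _; rewrite lee_fin.
rewrite [RHS]esum_mkcond; apply: eq_esum => j _.
case: ifPn => //; rewrite notin_setE /= => /negP js.
by rewrite fs.
Qed.

Lemma wnorm1E (R : realType) (Lam : countType) (w x : Lam -> R) :
  (forall j, 0 < w j) -> wnorm w 1 x = \esum_(j in setT) (w j * `|x j|)%:E.
Proof.
move=> w0; rewrite /wnorm invr1 poweRe1; last first.
  by apply: esum_ge0 => j _; rewrite lee_fin powR_ge0.
apply: eq_esum => j _; rewrite powRr1 // mulr_ge0 //; exact: ltW.
Qed.

Lemma wnorm2E (R : realType) (Lam : countType) (w x : Lam -> R) :
  (forall j, 0 < w j) ->
  wnorm w 2 x = ((\esum_(j in setT) (w j ^+ 2 * x j ^+ 2)%:E) `^ 2^-1)%E.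
Proof.
move=> w0; rewrite /wnorm; congr poweR; apply: eq_esum => j _.
by rewrite powR_mulrn ?mulr_ge0 ?(ltW (w0 j)) // exprMn real_normK ?num_real.
Qed.

(** * The source condition estimate on finite lists *)

Lemma small_coord_sum_le (R : realType) (I : Type) (s : seq I)
    (w r y : I -> R) (K t : R) :
  0 < t < 1 -> 0 <= K ->
  (forall j, 0 <= w j) -> (forall j, 0 <= r j) -> (forall j, 0 <= y j) ->
  (forall b : R, 0 < b ->
     \sum_(j <- s) (if w j * b < y j then w j * r j else 0) <= K * b `^ (- t)) ->
  forall b : R, 0 < b ->
  \sum_(j <- s) (if w j * b < y j then 0 else r j * y j) <=
    2 * (2 `^ (1 - t) - 1)^-1 * (K * b `^ (1 - t)).
Proof.
move=> /andP[t0 t1] K0 w0 r0 y0 hM.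
set q := 2 `^ (1 - t).
have q1 : 1 < q.
  rewrite -[1](powRr0 (2:R)) lt_neqAle; apply/andP; split; last first.
    by rewrite ler_powR ?subr_ge0 ?ler1n // ltW.
  rewrite powRr0 /q eq_sym powR_eq1; lra.
pose B := \sum_(j <- s) w j * r j.
have B0 : 0 <= B by apply: sumr_ge0 => j _; rewrite mulr_ge0.
(* The last term is what remains after [n] halvings, where a small coordinate is bounded crudely by
   y_j <= w_j b / 2^n. The factor c = 2/(q-1) is the fixed point of c = (2 + c)/q: one halving costs
   b (b/2)^(-t) = (2/q) b^(1-t), and the recursive term shrinks by 1/q. *)
have main n : forall b : R, 0 < b ->
    \sum_(j <- s) (if w j * b < y j then 0 else r j * y j) <=
    2 * (q - 1)^-1 * (K * b `^ (1 - t)) + b * B / 2 ^+ n.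
  elim: n => [|n IH] b b0.
    rewrite expr0 divr1 ler_wpDl //.
      by rewrite !mulr_ge0 ?powR_ge0 ?invr_ge0 //; lra.
    rewrite mulr_sumr; apply: ler_sum => j _.
    case: ltP => h; first by rewrite mulr_ge0 ?mulr_ge0 // ltW.
    apply: le_trans (ler_wpM2l (r0 j) h) _; rewrite le_eqVlt; apply/orP; left.
    by apply/eqP; ring.
  have b20 : 0 < b / 2 by lra.
  have hT2 := IH _ b20; have hM2 := hM _ b20.
  set T2 := \sum_(j <- s) _ in hT2; set M2 := \sum_(j <- s) _ in hM2.
  (* Coordinates with w_j b/2 < y_j <= w_j b are counted by [M2]; those below w_j b/2 stay in
     [T2]. *)
  have split_le : \sum_(j <- s) (if w j * b < y j then 0 else r j * y j) <=
      b * M2 + T2.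
    rewrite mulr_sumr -big_split; apply: ler_sum => j _ /=.
    case: (ltP (w j * b)) => h1; case: (ltP (w j * (b / 2))) => h2.
    - by rewrite addr0 !mulr_ge0 // ltW.
    - by rewrite mulr0 add0r mulr_ge0.
    - rewrite addr0; apply: le_trans (ler_wpM2l (r0 j) h1) _.
      by rewrite le_eqVlt; apply/orP; left; apply/eqP; ring.
    - by rewrite mulr0 add0r.
  apply: le_trans split_le _.
  have e1 : b * (b / 2) `^ (- t) = b `^ (1 - t) * (2 / q).
    rewrite powRM ?invr_ge0 ?(ltW b0) // mulrA -{1}[b]powRr1 ?(ltW b0) //.
    rewrite -powRD; last by rewrite (gt_eqF b0) implybT.
    congr (_ * _); rewrite -powR_inv1 // -powRrM /q -[X in X / _]powRr1 //.
    by rewrite -powRB ?pnatr_eq0 ?implybT //; congr (_ `^ _); ring.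
  have e2 : (b / 2) `^ (1 - t) = b `^ (1 - t) / q.
    rewrite powRM ?invr_ge0 ?(ltW b0) //; congr (_ * _).
    by rewrite -powR_inv1 // -powRrM mulrC powRrM powR_inv1 // powR_ge0.
  have h3 : b * M2 <= K * (b `^ (1 - t) * (2 / q)).
    by rewrite -e1 mulrCA ler_wpM2l // ltW.
  rewrite e2 in hT2; apply: le_trans (lerD h3 hT2) _.
  rewrite le_eqVlt; apply/orP; left; apply/eqP; rewrite exprS; field.
  rewrite expf_neq0 ?pnatr_eq0 //=; apply/andP; split; lra.
(* Let [n] grow: [B] is a finite sum independent of [n], and 2^n > n makes the remainder smaller
   than any [e]. *)
move=> b b0; apply/ler_addgt0Pr => e e0.
have [n hn] : exists n, b * B / 2 ^+ n <= e.
  exists (Num.truncn (e^-1 * (b * B))).+1; rewrite ler_pdivrMr ?exprn_gt0 //.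
  rewrite -ler_pdivrMl //; apply: (le_trans (ltW (truncnS_gt _))).
  by rewrite -natrX ler_nat ltnW // ltn_expl.
by apply: le_trans (main n b b0) _; rewrite lerD2l.
Qed.

(** At the balancing threshold, the two AM-GM terms of the large coordinates give one [G] each, and
    the small coordinates give 2 * 2/(2^(1-t) - 1) times [G]; this is the constant. Positivity of
    [E] makes the threshold positive. *)
Lemma vsc_seq_le (R : realType) (I : Type) (s : seq I)
    (a r u v : I -> R) (rho t E : R) :
  0 < t < 1 -> 0 < rho -> 0 < E ->
  (forall j, 0 < a j) -> (forall j, 0 < r j) ->
  (forall b : R, 0 < b ->
     \sum_(j <- s) (if a j ^- 2 * r j * b < `|u j| then a j ^- 2 * r j ^+ 2 else 0)
       <= rho `^ t * b `^ (- t)) ->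
  \sum_(j <- s) a j ^+ 2 * (u j - v j) ^+ 2 <= E ^+ 2 ->
  \sum_(j <- s) (r j * `|u j - v j| + r j * `|u j| - r j * `|v j|) <=
   (2 + 4 * (2 `^ (1 - t) - 1)^-1) *
     (E `^ ((2 - 2 * t) / (2 - t)) * rho `^ (t / (2 - t))).
Proof.
move=> t01 rho0 E0 a0 r0 hM hE.
have /andP[t0 t1] := t01.
(* The solution of b^(2-t) = E^2 rho^(-t), so that rho^t b^(1-t) and E^2/b agree; [G] is their
   common value. *)
pose b := E `^ (2 / (2 - t)) * rho `^ (- (t / (2 - t))).
set G := E `^ _ * rho `^ _.
have b0 : 0 < b by rewrite mulr_gt0 ?powR_gt0.
have t2 : 2 - t != 0 by rewrite gt_eqF //; lra.
have bG : rho `^ t * b `^ (1 - t) = G.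
  rewrite /b powRM ?powR_ge0 // -!powRrM mulrCA -powRD ?(gt_eqF rho0) ?implybT //.
  by congr (_ `^ _ * _ `^ _); field.
have EG : E ^+ 2 / b = G.
  rewrite /b invfM mulrA -!powRN opprK -powR_mulrn ?ltW // -powRD ?(gt_eqF E0) ?implybT //.
  by congr (_ `^ _ * _); field.
pose c j := a j ^- 2 * r j.
have c0 j : 0 < c j by rewrite mulr_gt0 // invr_gt0 exprn_gt0.
have K0 : 0 <= rho `^ t := powR_ge0 _ _.
have hM' (z : R) : 0 < z -> \sum_(j <- s) (if c j * z < `|u j| then c j * r j else 0)
    <= rho `^ t * z `^ (- t).
  move=> z0; apply: le_trans (hM z z0); rewrite le_eqVlt; apply/orP; left.
  by apply/eqP; apply: eq_bigr => j _; rewrite /c expr2 mulrA.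
have small := small_coord_sum_le _ _ _ _ _ _ _ _ t01 K0 (fun j => ltW (c0 j))
  (fun j => ltW (r0 j)) (fun j => normr_ge0 (u j)) hM' _ b0.
have large := hM' _ b0.
rewrite bG in small.
have bM : b * (rho `^ t * b `^ (- t)) = G.
  rewrite mulrCA -{1}[b]powRr1 ?(ltW b0) // -powRD ?(gt_eqF b0) ?implybT //.
have term j : r j * `|u j - v j| + r j * `|u j| - r j * `|v j| <=
    b * (if c j * b < `|u j| then c j * r j else 0) +
    b^-1 * (a j ^+ 2 * (u j - v j) ^+ 2) +
    2 * (if c j * b < `|u j| then 0 else r j * `|u j|).
  have d0 : 0 <= b^-1 * (a j ^+ 2 * (u j - v j) ^+ 2).
    by rewrite mulr_ge0 ?invr_ge0 ?(ltW b0) // mulr_ge0 ?sqr_ge0.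
  have n1 : `|u j| - `|v j| <= `|u j - v j| by exact: lerB_dist.
  have n2 : `|u j - v j| <= `|u j| + `|v j| by exact: ler_normB.
  rewrite -mulrDr -mulrBr.
  case: ifP => _.
  (* AM-GM: [2 r d <= b r^2 / a^2 + a^2 d^2 / b] *)
  - rewrite mulr0 addr0.
    have : r j * (`|u j - v j| + `|u j| - `|v j|) <= r j * (2 * `|u j - v j|).
      by rewrite ler_wpM2l ?(ltW (r0 j)) //; lra.
    move/le_trans; apply; rewrite -[(u j - v j) ^+ 2]real_normK ?num_real //.
    set d := `|_|; rewrite -subr_ge0.
    have -> : b * (c j * r j) + b^-1 * (a j ^+ 2 * d ^+ 2) - r j * (2 * d) =
        b * (r j / a j - b^-1 * (a j * d)) ^+ 2.
      by rewrite /c; field; rewrite !gt_eqF.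
    by rewrite mulr_ge0 ?sqr_ge0 // ltW.
  - rewrite mulr0 add0r ler_wpDl // mulrCA ler_wpM2l ?(ltW (r0 j)) //; lra.
apply: le_trans (ler_sum _ (fun j _ => term j)) _.
rewrite !big_split -!mulr_sumr /=.
have l1 : b * \sum_(j <- s) (if c j * b < `|u j| then c j * r j else 0) <= G.
  by rewrite -bM ler_wpM2l // ltW.
have l2 : b^-1 * \sum_(j <- s) a j ^+ 2 * (u j - v j) ^+ 2 <= G.
  by rewrite -EG [_ / b]mulrC ler_wpM2l // invr_ge0 ltW.
lra.
Qed.

(** * Norm bounds as bounds on finite sums, and the exponent arithmetic of the converse *)

Lemma kt_norm_leP (R : realType) (Lam : countType) (a r x : Lam -> R) (t K : R) :
  0 < t -> 0 <= K -> (forall j, 0 < a j) -> (forall j, 0 < r j) ->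
  (kt_norm a r t x <= K%:E)%E <->
  (forall (b : R) (s : seq Lam), 0 < b -> uniq s ->
    \sum_(j <- s) (if a j ^- 2 * r j * b < `|x j| then a j ^- 2 * r j ^+ 2 else 0)
      <= K `^ t * b `^ (- t)).
Proof.
move=> t0 K0 a0 r0.
have f0 b j : 0 <= if a j ^- 2 * r j * b < `|x j| then a j ^- 2 * r j ^+ 2 else 0.
  by case: ifP => // _; rewrite mulr_ge0 ?invr_ge0 ?sqr_ge0.
have tK : t^-1 * t = 1 by rewrite mulVf // gt_eqF.
(* Both directions fix [b] and trade b S^(1/t) <= K for S <= K^t b^(-t). The infinite sum is the
   supremum of its finite sums, so summability comes out of the bound. *)
split=> [hK b s b0 us|hK].
  have h1 : (b%:E * ((\esum_(j in setT)
      (if a j ^- 2 * r j * b < `|x j| then a j ^- 2 * r j ^+ 2 else 0)%:E)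
        `^ t^-1) <= K%:E)%E.
    by apply: le_trans hK; apply: ereal_sup_ubound; exists b.
  set S := \sum_(j <- s) _.
  have S0 : 0 <= S by apply: sumr_ge0.
  have h2 : b * S `^ t^-1 <= K.
    rewrite -lee_fin; apply: le_trans h1; rewrite EFinM lee_pmul2l ?lte_fin //.
    rewrite -poweR_EFin gt0_ler_poweR ?invr_ge0 ?(ltW t0) ?in_itv //= ?leey ?andbT ?lee_fin //.
    - by apply: esum_ge0 => j _; rewrite lee_fin.
    - exact: seq_le_esum.
  have : (b * S `^ t^-1) `^ t <= K `^ t.
    by apply: ge0_ler_powR; rewrite ?nnegrE ?(ltW t0) // mulr_ge0 ?powR_ge0 // ltW.
  rewrite powRM ?powR_ge0 ?(ltW b0) // -powRrM tK powRr1 // powRN.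
  by rewrite ler_pdivlMr ?powR_gt0 // mulrC.
apply: ge_ereal_sup => _ [b b0 <-].
have h1 : (\esum_(j in setT)
    (if (a j ^- 2 * r j * b < `|x j|)%R then a j ^- 2 * r j ^+ 2 else 0)%:E
    <= (K `^ t * b `^ (- t))%:E)%E.
  by apply: esum_le_seq => s us; rewrite lee_fin hK.
have : (b%:E * ((K `^ t * b `^ (- t))%:E `^ t^-1) <= K%:E)%E.
  rewrite poweR_EFin -EFinM lee_fin powRM ?powR_ge0 // -!powRrM mulNr mulfV ?gt_eqF //.
  by rewrite powRr1 // powR_inv1 ?(ltW b0) // mulrCA mulfV ?mulr1 // gt_eqF.
apply: le_trans; rewrite lee_pmul2l ?lte_fin //.
rewrite gt0_ler_poweR ?invr_ge0 ?(ltW t0) ?in_itv //= ?leey ?andbT ?lee_fin //.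
- by apply: esum_ge0 => j _; rewrite lee_fin.
- by rewrite mulr_ge0 ?powR_ge0.
Qed.

Lemma wnorm_le (R : realType) (Lam : countType) (w x z : Lam -> R) (p : R) :
  (forall j, 0 < w j) -> 0 <= p -> (forall j, `|z j| <= `|x j|) ->
  (wnorm w p z <= wnorm w p x)%E.
Proof.
move=> w0 p0 zx.
have s0 (y : Lam -> R) : (0 <= \esum_(j in setT) ((w j * `|y j|) `^ p)%:E)%E.
  by apply: esum_ge0 => j _; rewrite lee_fin powR_ge0.
rewrite gt0_ler_poweR ?invr_ge0 ?in_itv //= ?leey ?andbT //.
apply: le_esum => j _; rewrite lee_fin.
by rewrite ge0_ler_powR ?nnegrE ?ler_wpM2l ?mulr_ge0 ?normr_ge0 // ltW.
Qed.

Lemma wnorm2_sum_le (R : realType) (Lam : countType) (w x : Lam -> R) (E : R) :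
  (forall j, 0 < w j) -> 0 <= E -> (wnorm w 2 x <= E%:E)%E ->
  forall s : seq Lam, uniq s -> \sum_(j <- s) w j ^+ 2 * x j ^+ 2 <= E ^+ 2.
Proof.
move=> w0 E0; rewrite wnorm2E // => hE s us.
have f0 j : 0 <= w j ^+ 2 * x j ^+ 2 by rewrite mulr_ge0 ?sqr_ge0.
set S := \sum_(j <- s) _.
have S0 : 0 <= S by apply: sumr_ge0.
have h : S `^ 2^-1 <= E.
  rewrite -lee_fin; apply: le_trans hE; rewrite -poweR_EFin.
  rewrite gt0_ler_poweR ?invr_ge0 ?in_itv //= ?leey ?andbT ?lee_fin //.
  - by apply: esum_ge0 => j _; rewrite lee_fin.
  - exact: seq_le_esum.
rewrite powR12_sqrt // in h.
by rewrite -[S]sqr_sqrtr // lerXn2r ?nnegrE ?sqrtr_ge0.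
Qed.

(** Raised to the power 2-t, the hypothesis has n^(2-t) on the left and n^(1-t) on the right, so
    exactly one factor [n] survives cancellation; the powers of [b] leave b^(-t). *)
Lemma powR_interpolation_bound (R : realType) (b n C L t : R) :
  0 < t < 1 -> 0 < b -> 0 < n -> 0 < C -> 0 < L ->
  b * n <= C * (L * (b ^+ 2 * n) `^ 2^-1) `^ ((2 - 2 * t) / (2 - t)) ->
  n <= (L `^ ((2 - 2 * t) / t) * C `^ ((2 - t) / t)) `^ t * b `^ (- t).
Proof.
move=> /andP[t0 t1] b0 n0 C0 L0 h.
have t2 : 0 < 2 - t by lra.
have tn : t != 0 by rewrite gt_eqF.
have t2n : 2 - t != 0 by rewrite gt_eqF.
have bn : b ^+ 2 * n != 0 by rewrite gt_eqF // mulr_gt0 ?exprn_gt0.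
have h2 : (b * n) `^ (2 - t) <= C `^ (2 - t) * (L `^ (2 - 2 * t) *
    (b `^ (2 - 2 * t) * n `^ (1 - t))).
  have l0 : 0 <= b * n by rewrite mulr_ge0 ?(ltW b0) ?(ltW n0).
  have := ge0_ler_powR (ltW t2) l0 (le_trans l0 h) h.
  move=> /le_trans; apply; rewrite le_eqVlt; apply/orP; left; apply/eqP.
  rewrite powRM ?powR_ge0 ?(ltW C0) // -powRrM powRM ?powR_ge0 ?(ltW L0) //.
  rewrite -powRrM powRM ?exprn_ge0 ?(ltW b0) ?(ltW n0) //.
  rewrite -(powR_mulrn 2 (ltW b0)) -powRrM.
  by congr (_ * (_ `^ _ * (_ `^ _ * _ `^ _))); field.
have -> : (L `^ ((2 - 2 * t) / t) * C `^ ((2 - t) / t)) `^ t =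
    L `^ (2 - 2 * t) * C `^ (2 - t).
  by rewrite powRM ?powR_ge0 // -!powRrM; congr (_ `^ _ * _ `^ _); field.
have c0 : 0 < b `^ (2 - 2 * t) * n `^ (1 - t) by rewrite mulr_gt0 ?powR_gt0.
rewrite -(ler_pM2r c0).
have -> : n * (b `^ (2 - 2 * t) * n `^ (1 - t)) = (b * n) `^ (2 - t) * b `^ (- t).
  rewrite powRM ?(ltW b0) ?(ltW n0) // mulrCA mulrAC -powRD ?(gt_eqF b0) ?implybT //.
  rewrite -{1}[n]powRr1 ?(ltW n0) // -powRD ?(gt_eqF n0) ?implybT //.
  by congr (_ `^ _ * _ `^ _); ring.
apply: le_trans (ler_wpM2r (powR_ge0 b (- t)) h2) _.
by rewrite le_eqVlt; apply/orP; left; apply/eqP; ring.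
Qed.

(** * The two implications for sequences *)

Lemma kt_norm_vsc (R : realType) (Lam : countType) (Y : normedModType R)
    (a r : Lam -> R) (D : set (Lam -> R)) (F : (Lam -> R) -> Y) (L t rho : R)
    (xp : Lam -> R) :
  (forall j, 0 < a j) -> (forall j, 0 < r j) -> 0 < L ->
  (forall x, D x ->
     ((L^-1)%:E * wnorm a 2 (seqsub xp x) <= (`|F xp - F x|)%:E)%E) ->
  0 < t < 1 -> 0 < rho -> (kt_norm a r t xp <= rho%:E)%E ->
  vsc r D F xp
    ((2 + 4 * (2 `^ (1 - t) - 1)^-1) * L `^ ((2 - 2 * t) / (2 - t))
      * rho `^ (t / (2 - t)))
    ((2 - 2 * t) / (2 - t)).
Proof.
move=> a0 r0 L0 lip t01 rho0; have /andP[t0 t1] := t01.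
move=> /(kt_norm_leP _ _ _ _ _ _ _ t0 (ltW rho0) a0 r0) hM x Dx xl1.
set delta := `|F xp - F x|.
set e := (2 - 2 * t) / (2 - t).
set B := (X in (_ <= X%:E)%E).
have d0 : 0 <= delta by exact: normr_ge0.
have E0 : 0 <= L * delta by rewrite mulr_ge0 // ltW.
have hE : (wnorm a 2 (seqsub xp x) <= (L * delta)%:E)%E.
  by rewrite EFinM -lee_pdivrMl ?lip.
have {}hE := wnorm2_sum_le _ _ _ _ _ a0 E0 hE.
have seqB s : uniq s ->
    \sum_(j <- s) (r j * `|xp j - x j| + r j * `|xp j| - r j * `|x j|) <= B.
  (* If [delta] is 0, no positive threshold is available, but the lower Lipschitz bound forces [xp]
     and [x] to agree, so every term vanishes. The exponent must be nonzero here because 0 to the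
     power 0 is 1. *)
  move=> us; have [dz|dn] := eqVneq delta 0.
    have e0 : e != 0 by rewrite mulf_neq0 ?invr_neq0 // gt_eqF //; lra.
    rewrite /B dz powR0 // mulr0 big1 // => j _.
    have := hE [:: j] isT; rewrite big_seq1 dz mulr0 expr0n /=.
    rewrite pmulr_rle0 ?exprn_gt0 // => h.
    have : (xp j - x j) ^+ 2 == 0 by rewrite eq_le h sqr_ge0.
    by rewrite sqrf_eq0 subr_eq0 => /eqP ->; rewrite subrr normr0 mulr0 add0r subrr.
  have Ep : 0 < L * delta by rewrite mulr_gt0 // lt_neqAle eq_sym dn.
  apply: le_trans (vsc_seq_le _ _ s a r xp x rho t _ t01 rho0 Ep a0 r0 _ (hE s us)) _.
    by move=> b b0; exact: hM.
  by rewrite powRM ?(ltW L0) // /B le_eqVlt; apply/orP; left; apply/eqP; ring.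
have n0 (y : Lam -> R) j : 0 <= r j * `|y j| by rewrite mulr_ge0 // ltW.
have xfin : wnorm r 1 x \is a fin_num.
  by rewrite ge0_fin_numE // wnorm1E //; apply: esum_ge0 => j _; rewrite lee_fin.
(* Only the norm of [x] is known to be finite. Moving it to the right leaves a sum of nonnegative
   terms, which can be tested on finite lists. *)
rewrite leeBlDr // !wnorm1E // -esumD; first last.
- by move=> j _; rewrite lee_fin.
- by move=> j _; rewrite lee_fin.
apply: (esum_le_seq _ _ (fun j => r j * `|xp j - x j| + r j * `|xp j|)) => s us.
apply: (@le_trans _ _ (B%:E + (\sum_(j <- s) r j * `|x j|)%:E)%E).
  by rewrite -EFinD lee_fin -lerBlDr -sumrB seqB.
by rewrite leeD2l // seq_le_esum.
Qed.

Lemma vsc_kt_norm (R : realType) (Lam : countType) (Y : normedModType R)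
    (a r : Lam -> R) (D : set (Lam -> R)) (F : (Lam -> R) -> Y) (L t C : R)
    (xp : Lam -> R) :
  (forall j, 0 < a j) -> (forall j, 0 < r j) ->
  D `<=` in_lp a 2 -> D `&` in_lp r 1 !=set0 -> 0 < L ->
  (forall x, D x ->
     ((`|F xp - F x|)%:E <= L%:E * wnorm a 2 (seqsub xp x))%E) ->
  0 < t < 1 -> D xp -> shrink_closed a D -> 0 < C ->
  vsc r D F xp C ((2 - 2 * t) / (2 - t)) ->
  (kt_norm a r t xp <= (L `^ ((2 - 2 * t) / t) * C `^ ((2 - t) / t))%:E)%E.
Proof.
move=> a0 r0 Da [x0 [Dx0 x0l1]] L0 lip t01 Dxp shr C0 hvsc.
have /andP[t0 t1] := t01.
have norm_ge0 (y : Lam -> R) : (0 <= wnorm r 1 y)%E.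
  by rewrite wnorm1E //; apply: esum_ge0 => j _; rewrite lee_fin mulr_ge0 // ltW.
have norm_fin y : in_lp r 1 y -> wnorm r 1 y \is a fin_num.
  by move=> yl1; rewrite ge0_fin_numE.
(* Testing the source condition at [x0] bounds the norm of [xp] by a real number plus the finite
   norm of [x0]. *)
have xpl1 : in_lp r 1 xp.
  have := hvsc _ Dx0 x0l1; rewrite leeBlDr ?norm_fin // => h.
  apply: (@le_lt_trans _ _ (wnorm r 1 (seqsub xp x0) + wnorm r 1 xp)%E).
    by rewrite leeDr.
  by apply: le_lt_trans h _; rewrite lte_add_pinfty // ltry.
apply/kt_norm_leP => //; first by rewrite mulr_ge0 ?powR_ge0.
move=> b s b0 us; rewrite -big_mkcond -big_filter.
set s' := seq.filter _ s; set n := \sum_(j <- s') _.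
have us' : uniq s' by rewrite filter_uniq.
have n0 : 0 <= n.
  by apply: sumr_ge0 => j _; rewrite mulr_ge0 ?invr_ge0 ?sqr_ge0.
have [nz|nn] := eqVneq n 0; first by rewrite nz mulr_ge0 ?powR_ge0.
have np : 0 < n by rewrite lt_neqAle eq_sym nn.
(* [d] is the amount removed by soft-thresholding. It never exceeds |xp_j|, so [x] is dominated by
   [xp] and lies in [D] by shrinkage. *)
pose d j := if j \in s' then a j ^- 2 * r j * b else 0.
pose x j := xp j - Num.sg (xp j) * d j.
have d0 j : 0 <= d j.
  rewrite /d; case: ifP => // _.
  by rewrite !mulr_ge0 ?invr_ge0 ?sqr_ge0 // ltW.
have dxp j : d j <= `|xp j|.
  by rewrite /d; case: ifP => // ; rewrite mem_filter => /andP[/ltW].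
have normd j : `|seqsub xp x j| = d j.
  rewrite /seqsub /x subKr normrM normr_sg (ger0_norm (d0 j)).
  (* The sign is 0 where [xp] vanishes, but there [dxp] makes [d] vanish too. *)
  case: eqVneq => [xpz|_]; last by rewrite mul1r.
  by have := dxp j; rewrite xpz normr0 mul0r => h; apply/eqP; rewrite eq_le d0 h.
have xxp j : `|x j| <= `|xp j|.
  have -> : x j = Num.sg (xp j) * (`|xp j| - d j).
    by rewrite mulrBr -numEsg.
  rewrite normrM normr_sg ger0_norm ?subr_ge0 //.
  apply: (@le_trans _ _ (`|xp j| - d j)); last by rewrite lerBlDr lerDl.
  by rewrite ler_piMl ?subr_ge0 // lern1; case: (_ == _).
have Dx : D x.
  by apply: (shr xp) => //; apply: le_lt_trans (Da _ Dxp); apply: wnorm_le.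
have xl1 : in_lp r 1 x by apply: le_lt_trans xpl1; exact: wnorm_le.
have norm1 : wnorm r 1 (seqsub xp x) = (b * n)%:E.
  rewrite wnorm1E // (esum_seq_supp _ _ _ s') //.
  - congr EFin; rewrite mulr_sumr [LHS]big_seq [RHS]big_seq; apply: eq_bigr => j js.
    by rewrite normd /d js; ring.
  - by move=> j; rewrite mulr_ge0 // ltW.
  - by move=> j js; rewrite normd /d (negPf js) mulr0.
have norm2 : wnorm a 2 (seqsub xp x) = ((b ^+ 2 * n) `^ 2^-1)%:E.
  rewrite wnorm2E // (esum_seq_supp _ _ _ s') //.
  - rewrite poweR_EFin; congr (_ `^ _)%:E.
    rewrite mulr_sumr [LHS]big_seq [RHS]big_seq; apply: eq_bigr => j js.
    rewrite -[seqsub _ _ _ ^+ 2]real_normK ?num_real // normd /d js; field.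
    by rewrite gt_eqF.
  - by move=> j; rewrite mulr_ge0 ?sqr_ge0.
  - move=> j js; rewrite -[seqsub _ _ _ ^+ 2]real_normK ?num_real // normd /d.
    by rewrite (negPf js) expr0n mulr0.
have le_delta : `|F xp - F x| <= L * (b ^+ 2 * n) `^ 2^-1.
  by rewrite -lee_fin EFinM -norm2 lip.
apply: powR_interpolation_bound => //.
have e0 : 0 <= (2 - 2 * t) / (2 - t) by rewrite divr_ge0 //; lra.
apply: (@le_trans _ _ (C * `|F xp - F x| `^ ((2 - 2 * t) / (2 - t)))).
  rewrite -lee_fin; apply: le_trans (hvsc _ Dx xl1); rewrite leeBrDr ?norm_fin //.
  by rewrite norm1 leeD2l // wnorm_le.
rewrite ler_wpM2l ?(ltW C0) // ge0_ler_powR ?nnegrE //.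
by rewrite mulr_ge0 ?powR_ge0 // ltW.
Qed.

Theorem theorem4p3 (R : realType) (Lam : countType) (Y : completeNormedModType R)
  (a r : Lam -> R) (D : set (Lam -> R)) (F : (Lam -> R) -> Y) (L t : R)
  (xp : Lam -> R) :
  (forall j, 0 < a j) -> (forall j, 0 < r j) -> ratio_to_zero a r ->
  closed_in_l2 a D -> (D `&` in_lp r 1 !=set0) ->
  0 < L ->
  (forall x1 x2, D x1 -> D x2 ->
     ((L^-1)%:E * wnorm a 2 (seqsub x1 x2) <= (`|F x1 - F x2|)%:E)%E /\
     ((`|F x1 - F x2|)%:E <= L%:E * wnorm a 2 (seqsub x1 x2))%E) ->
  0 < t < 1 -> D xp ->
  (forall rho : R, 0 < rho -> (kt_norm a r t xp <= rho%:E)%E ->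
     vsc r D F xp
       ((2 + 4 * (2 `^ (1 - t) - 1)^-1) * L `^ ((2 - 2 * t) / (2 - t))
          * rho `^ (t / (2 - t)))
       ((2 - 2 * t) / (2 - t))) /\
  (shrink_closed a D ->
   forall C : R, 0 < C ->
     vsc r D F xp C ((2 - 2 * t) / (2 - t)) ->
     (kt_norm a r t xp <= (L `^ ((2 - 2 * t) / t) * C `^ ((2 - t) / t))%:E)%E).
Proof.
move=> a0 r0 _ [Da _] Dl1 L0 lip t01 Dxp; split=> [rho rho0|shr C C0].
  by apply: kt_norm_vsc => // x Dx; case: (lip _ _ Dxp Dx).
by apply: vsc_kt_norm => // x Dx; case: (lip _ _ Dxp Dx).
Qed.
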